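(* Let $G$ be a simple undirected graph with $n$ vertices ($n\in\mathbb{N}$). Then $G$ is a tree if and only if every coding sequence $\beta(G,n)$ of $G$ is a basis of the vector space $\mathbb{Z}_2^{n-1}$ over the field $\mathbb{Z}_2$.
   Context: Coding sequences: let $G=(V,E)$ be a simple undirected graph with $n$ vertices. Choose a labeling of the vertices $V=\{v_0,v_1,\ldots,v_{n-1}\}$ (i.e. a bijection from $V$ to $\{0,\dots,n-1\}$; vertex $v_i$ is also referred to as $10^i$). For an edge $e=v_iv_j$ with $i>j$ define $f^\#(e)=(x_1,\ldots,x_{n-1})\in\mathbb{Z}_2^{n-1}$ by $x_k=1$ iff $n-i\le k\le n-j-1$, and $x_k=0$ otherwise (equivalently, $x_k=1$ iff the $(n-k)$-th decimal digit from the right of $10^i-10^j$ is $9$). The coding sequence $\beta(G,n)$ associated with this labeling is the set $\{f^\#(e): e\in E\}$ (the empty set if $E=\emptyset$). Different labelings may give different coding sequences; ''every coding sequence'' means the one obtained from any labeling. *)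

(* Defs.v *)
From HB Require Import structures.
From mathcomp Require Import all_boot all_order all_algebra.

Set Implicit Arguments.
Unset Strict Implicit.
Unset Printing Implicit Defensive.

Import GRing.Theory.

Local Open Scope ring_scope.

(* A finite simple graph is a finType of vertices with a symmetric irreflexive
   adjacency relation. *)

Definition connected_graph (V : finType) (adj : rel V) : Prop :=
  forall u v : V, connect adj u v.

(* The size bound excludes u :: v :: nil, which is a ucycle as soon as u and v
   are adjacent. *)
Definition acyclic_graph (V : finType) (adj : rel V) : Prop :=
  ~ exists2 c : seq V, ucycle adj c & (3 <= size c)%N.

(* The graph with no vertex also satisfies this definition; it is to be used
   on nonempty graphs. *)
Definition is_tree (V : finType) (adj : rel V) : Prop :=
  connected_graph adj /\ acyclic_graph adj.

(* Code of the edge v_i v_j, where j < i < n: the coordinates x_1, ..., x_(n-1)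
   are numbered from 1, so x_k is stored at column k - 1. *)
Definition edge_code (n i j : nat) : 'rV['F_2]_n.-1 :=
  \row_(k < n.-1) (if (n - i <= k.+1 <= n - j - 1)%N then 1 else 0).

(* The vertex v_i is the one with lab v_i = i; each edge is listed once, as the
   pair whose first component is its endpoint of larger label. *)
Definition coding_sequence (V : finType) (adj : rel V) (n : nat)
    (lab : V -> 'I_n) : {set 'rV['F_2]_n.-1} :=
  [set edge_code n (lab e.1) (lab e.2)
     | e : V * V & adj e.1 e.2 && (lab e.2 < lab e.1)%N].

(* Main.v *)
Require Import Defs.
From HB Require Import structures.
From mathcomp Require Import all_boot all_order all_algebra.
From mathcomp Require Import zify.

Set Implicit Arguments.
Unset Strict Implicit.
Unset Printing Implicit Defensive.

(** The code of [v_i v_j] is [p_i - p_j], where [p_i] has a 1 exactly in the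
    last [i] coordinates. Hence the codes of a graph span [p_u - p_v] if and
    only if [u] and [v] are connected: a path gives a telescoping sum, and the
    indicator function of the component of [u] induces a linear form that
    kills all the codes and separates [p_u] from [p_v] otherwise. So the codes
    span the space iff the graph is connected; applied to the graph with one
    edge removed, the same fact shows that the codes are independent iff every
    edge is a bridge, i.e. iff the graph is acyclic. *)

Import GRing.Theory.
Local Open Scope ring_scope.

Definition suffix_row (n i : nat) : 'rV['F_2]_n.-1 :=
  \row_(k < n.-1) (n - i <= k.+1)%N%:R.

Lemma edge_codeE n i j : (j <= i)%N ->
  edge_code n i j = suffix_row n i - suffix_row n j.
Proof.
move=> le_ji; apply/rowP=> k; rewrite !mxE.
have [le_ik|lt_ki] /= := leqP (n - i) k.+1; last first.
  by rewrite (_ : (n - j <= _)%N = false) ?subr0 //; lia.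
have [le_jk|lt_kj] := leqP (n - j) k.+1.
  by rewrite (_ : (_ <= _ - 1)%N = false) ?subrr //; lia.
by rewrite (_ : (_ <= _ - 1)%N) ?subr0 //; lia.
Qed.

(** The support of a code is a nonempty interval of coordinates, and its two ends give back the two
    labels. *)
Lemma edge_code_inj n i j i' j' : (j < i < n)%N -> (j' < i' < n)%N ->
  edge_code n i j = edge_code n i' j' -> i = i' /\ j = j'.
Proof.
have nested a b a' b' : (b < a < n)%N -> (b' < a' < n)%N ->
    edge_code n a b = edge_code n a' b' -> (a <= a')%N /\ (b' <= b)%N.
  move=> lt_ban lt_ba'n /rowP eq_code.
  have supp k : (k < n.-1)%N -> (n - a <= k.+1 <= n - b - 1)%N ->
      (n - a' <= k.+1 <= n - b' - 1)%N.
    move=> lt_kn; have := eq_code (Ordinal lt_kn); rewrite !mxE /=.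
    by do 2 case: ifP.
  have first_in : (n - a' <= (n - a).-1.+1 <= n - b' - 1)%N by apply: supp; lia.
  have last_in : (n - a' <= (n - b).-2.+1 <= n - b' - 1)%N by apply: supp; lia.
  by lia.
move=> lt_jin lt_ji'n eq_code.
have := nested _ _ _ _ lt_jin lt_ji'n eq_code.
have := nested _ _ _ _ lt_ji'n lt_jin (esym eq_code).
by lia.
Qed.

Lemma suffix_row_span n (U : {vspace 'rV['F_2]_n.-1}) :
  (forall i j, (i < n)%N -> (j < n)%N -> suffix_row n i - suffix_row n j \in U) ->
  U = {: 'rV['F_2]_n.-1}%VS.
Proof.
move=> inU; apply/eqP; rewrite eqEsubv subvf /=; apply/subvP=> x _.
rewrite [x]row_sum_delta; apply: memv_suml => k _; apply: memvZ.
(* The ones of [suffix_row n i] start at column [n.-1 - i], so consecutive suffix rows differ by one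
   basis vector. *)
have -> : delta_mx 0 k = suffix_row n (n.-1 - k) - suffix_row n (n.-1 - k.+1).
  apply/rowP=> l; rewrite !mxE /=.
  have := ltn_ord k; have := ltn_ord l; rewrite -val_eqE /= => ltl ltk.
  have -> : (n - (n.-1 - k) <= l.+1)%N = (k <= l)%N by lia.
  have -> : (n - (n.-1 - k.+1) <= l.+1)%N = (k < l)%N by lia.
  by case: (ltngtP k l) => //=; rewrite ?subrr ?subr0.
by have := ltn_ord k => ltk; apply: inU; lia.
Qed.

(** The nonzero suffix rows form a basis, so a linear form can be prescribed on them; the shift by
    [h 0] is forced by [suffix_row n 0 = 0]. *)
Lemma suffix_row_functional n (h : nat -> 'F_2) :
  exists D : 'cV['F_2]_n.-1, forall i, (i < n)%N ->
    suffix_row n i *m D = (h i - h 0%N)%:M.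
Proof.
(* Entry [k] is the increment of [h] between the two labels whose suffix rows differ by the [k]-th
   basis vector; the sum telescopes. *)
exists (\col_(k < n.-1) (h (n.-1 - k)%N - h (n.-1 - k.+1)%N)).
elim=> [|i IHi] lt_in.
  rewrite subrr; apply/rowP=> k; rewrite !mxE [RHS]mul0rn big1 // => l _.
  have := ltn_ord l; rewrite !mxE => ltl.
  by rewrite (_ : (_ <= _)%N = false) ?mul0r //; lia.
have lt_kn : (n.-1 - i.+1 < n.-1)%N by lia.
have -> : suffix_row n i.+1 = suffix_row n i + delta_mx 0 (Ordinal lt_kn).
  apply/rowP=> l; rewrite !mxE /= -val_eqE /=; have := ltn_ord l => ltl.
  have -> : (n - i.+1 <= l.+1)%N = (n.-1 - i.+1 <= l)%N by lia.
  have -> : (n - i <= l.+1)%N = (n.-1 - i.+1 < l)%N by lia.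
  by case: (ltngtP (n.-1 - i.+1)%N l); rewrite ?addr0 ?add0r.
rewrite mulmxDl IHi 1?ltnW // -rowE.
apply/rowP=> k; rewrite !mxE /= ord1 eqxx !mulr1n.
have -> : (n.-1 - (n.-1 - i.+1) = i.+1)%N by lia.
have -> : (n.-1 - (n.-1 - i.+1).+1 = i)%N by lia.
by rewrite addrC addrA subrK.
Qed.

Section Coding.

Variables (n : nat) (V : finType) (lab : V -> 'I_n).
Hypothesis lab_inj : injective lab.

Local Notation codes r := <<enum (coding_sequence r lab)>>%VS.
Local Notation diff u v := (suffix_row n (lab u) - suffix_row n (lab v)).

Lemma code_in_sequence (r : rel V) u v : r u v -> (lab v < lab u)%N ->
  edge_code n (lab u) (lab v) \in coding_sequence r lab.
Proof. by move=> ruv lt_vu; apply/imsetP; exists (u, v); rewrite ?inE /= ?ruv. Qed.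

Lemma connect_codes (r : rel V) u v : symmetric r ->
  connect r u v <-> diff u v \in codes r.
Proof.
move=> r_sym; split.
  have step x y : r x y -> diff x y \in codes r.
    (* Codes are listed with the larger label first; swapping the endpoints only changes the
       sign. *)
    wlog le_yx : x y / (lab y <= lab x)%N => [wl rxy|].
      case: (leqP (lab y) (lab x)) => [/wl|/ltnW/wl]; first exact.
      by rewrite r_sym -opprB memvN; apply.
    move: le_yx; rewrite leq_eqVlt => /predU1P[/val_inj/lab_inj-> _|lt_yx rxy].
      by rewrite subrr mem0v.
    by rewrite -edge_codeE 1?ltnW // memv_span // mem_enum code_in_sequence.
  case/connectP=> p; elim: p u => [|w p IHp] u /= => [_ ->|/andP[ruw rp] lastp].
    by rewrite subrr mem0v.
  rewrite -(subrK (suffix_row n (lab w)) (suffix_row n (lab u))) -addrA.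
  by apply: memvD; [apply: step | apply: IHp].
(* The indicator of the component of [u], carried over to labels. *)
pose h i : 'F_2 := [exists w, (lab w == i :> nat) && connect r u w]%:R.
have hE w : h (lab w) = (connect r u w)%:R.
  rewrite /h; congr (nat_of_bool _)%:R.
  apply/existsP/idP => [[w' /andP[/eqP]]|cw].
    by move/val_inj/lab_inj->.
  by exists w; rewrite eqxx.
have [D DE] := suffix_row_functional n h.
have diffD x y : diff x y *m D = (h (lab x) - h (lab y))%:M.
  by rewrite mulmxBl !DE // -raddfB /= opprB addrA subrK.
move=> in_codes.
have: (codes r <= lker (linfun (mulmxr D)))%VS.
  apply/span_subvP=> x; rewrite mem_enum => /imsetP[[a b]]; rewrite inE /=.
  case/andP=> rab lt_ba ->; rewrite memv_ker lfunE /= edge_codeE 1?ltnW //.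
  rewrite diffD !hE (same_connect_r (sym_connect_sym r_sym) (connect1 rab)).
  by rewrite subrr raddf0.
move/subvP/(_ _ in_codes); rewrite memv_ker lfunE /= diffD !hE connect0.
by case: (connect r u v) => // /eqP/matrixP/(_ 0 0); rewrite !mxE eqxx.
Qed.

Lemma codes_full (r : rel V) : symmetric r -> bijective lab ->
  connected_graph r <-> codes r = {: 'rV['F_2]_n.-1}%VS.
Proof.
move=> r_sym [lab' _ labK]; split=> [conn|full u v]; last first.
  by apply/(connect_codes _ _ r_sym); rewrite full memvf.
apply: suffix_row_span => i j lt_in lt_jn.
have := conn (lab' (Ordinal lt_in)) (lab' (Ordinal lt_jn)).
by move/(connect_codes _ _ r_sym); rewrite !labK.
Qed.

Definition remove_edge (r : rel V) (a b : V) : rel V :=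
  [rel x y | [&& r x y, (x, y) != (a, b) & (x, y) != (b, a)]].

Lemma remove_edgeC (r : rel V) a b : remove_edge r a b =2 remove_edge r b a.
Proof. by move=> x y; rewrite /remove_edge /= [X in _ && X]andbC. Qed.

Lemma remove_edge_sym (r : rel V) a b :
  symmetric r -> symmetric (remove_edge r a b).
Proof.
move=> r_sym x y; rewrite /remove_edge /= r_sym !xpair_eqE.
by rewrite (andbC (x == a)) (andbC (x == b)) [X in _ && X]andbC.
Qed.

(** Distinct edges have distinct codes, so no other edge contributes the code that is dropped. *)
Lemma coding_remove_edge (r : rel V) a b : (lab b < lab a)%N ->
  coding_sequence (remove_edge r a b) lab =
    coding_sequence r lab :\ edge_code n (lab a) (lab b).
Proof.
move=> lt_ba; apply/setP=> x; rewrite in_setD1.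
apply/imsetP/andP => [[[c d]]|[neq_x /imsetP[[c d]]]]; rewrite inE /=.
  case/andP=> /and3P[rcd neq_ab _] lt_dc ->; split; last exact: code_in_sequence.
  apply: contraNneq neq_ab => /edge_code_inj[]; rewrite ?lt_dc ?lt_ba ?ltn_ord //.
  by move=> /val_inj/lab_inj-> /val_inj/lab_inj->.
case/andP=> rcd lt_dc eq_x; exists (c, d) => //.
rewrite inE /remove_edge /= rcd lt_dc andbT /=.
apply/andP; split; first by apply: contraNneq neq_x => -[<- <-]; rewrite eq_x.
by apply: contraTneq lt_dc => -[-> ->]; rewrite -leqNgt ltnW.
Qed.

(** A family is free iff no member lies in the span of the others; by [connect_codes] on the graph
    without [ab], the code of [ab] lies there iff [ab] is not a bridge. *)
Lemma codes_free (r : rel V) : symmetric r -> irreflexive r ->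
  free (enum (coding_sequence r lab)) <->
  (forall a b, r a b -> ~~ connect (remove_edge r a b) a b).
Proof.
move=> r_sym r_irr; set S := coding_sequence r lab.
have bridge a b : r a b -> (lab b < lab a)%N ->
    connect (remove_edge r a b) a b <->
    edge_code n (lab a) (lab b) \in <<enum (S :\ edge_code n (lab a) (lab b))>>%VS.
  move=> rab lt_ba; rewrite -coding_remove_edge // {1}edge_codeE 1?ltnW //.
  exact/connect_codes/remove_edge_sym.
split=> [free_S a b|bridges].
  wlog le_ba : a b / (lab b <= lab a)%N => [wl rab|rab].
    case: (leqP (lab b) (lab a)) => [/wl|/ltnW/wl]; first exact.
    rewrite r_sym => /(_ rab); apply: contraNN => conn_ab.
    rewrite (sym_connect_sym (remove_edge_sym _ _ r_sym)).
    by rewrite (eq_connect (remove_edgeC _ _ _)).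
  have lt_ba : (lab b < lab a)%N.
    rewrite ltn_neqAle le_ba andbT; apply: contraTneq rab.
    by move=> /val_inj/lab_inj->; rewrite r_irr.
  apply/negP=> /(bridge _ _ rab lt_ba); apply/negP.
  have in_S := code_in_sequence rab lt_ba.
  suff: free (edge_code n (lab a) (lab b)
              :: enum (S :\ edge_code n (lab a) (lab b))).
    by rewrite free_cons => /andP[].
  rewrite -(perm_free (X := enum S)) //; apply: uniq_perm.
  - exact: enum_uniq.
  - by rewrite /= enum_uniq mem_enum setD11.
  - by move=> x; rewrite inE !mem_enum in_setD1; case: eqP => // ->.
(* A dependent list has an entry in the span of the entries after it. As [enum S] has no repetition,
   these all differ from that entry. *)
apply/negPn; rewrite (freeNE (in_tuple (enum S))).
apply/existsP=> -[[i lt_i] /=]; set x := _`_i => in_span.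
have: x \in S by rewrite -mem_enum mem_nth.
case/imsetP=> -[a b]; rewrite inE /= => /andP[rab lt_ba] eq_x.
have /negP[] := bridges a b rab; apply/(bridge _ _ rab lt_ba).
rewrite -eq_x; apply: subvP in_span; apply: sub_span => y y_drop.
rewrite mem_enum in_setD1 -mem_enum (mem_drop y_drop) andbT.
apply: contraTneq y_drop => ->.
have := enum_uniq S; rewrite -{1}(cat_take_drop i (enum S)) (drop_nth 0) // -/x eq_x.
by rewrite cat_uniq /= => /and3P[_ _ /andP[]].
Qed.

End Coding.

Lemma acyclic_bridges (V : finType) (r : rel V) : symmetric r -> irreflexive r ->
  acyclic_graph r <-> (forall a b, r a b -> ~~ connect (remove_edge r a b) a b).
Proof.
move=> r_sym r_irr; split=> [acyc a b rab|bridges [[|x [|y [|z s]]] //]].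
  apply/negP=> /connectP[p0 path_p0]; case/shortenP: path_p0 => p path_p uniq_p _ lb.
  apply: acyc; exists (a :: p).
    rewrite /ucycle uniq_p /= rcons_path -lb r_sym rab !andbT.
    by apply: sub_path path_p => x y /= /andP[].
  (* The cycle has at least three vertices: an empty [p] would make [ab] a loop, and a single step
     would be the removed edge. *)
  case: p path_p lb {uniq_p} => [|c [|d p]] //= => [_ eq_ab|].
    by rewrite eq_ab r_irr in rab.
  by move=> + eq_bc; rewrite /remove_edge /= -eq_bc eqxx !andbF.
case/andP=> /= /and3P[rxy ryz path_z] /and3P[].
rewrite !inE !negb_or => /and3P[neq_xy neq_xz _] /andP[neq_yz y_s] _ _.
have /negP[] := bridges x y rxy.
rewrite (sym_connect_sym (remove_edge_sym _ _ r_sym)).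
(* The rest of the cycle leads from [y] back to [x]. Its first step ends at [z], which is not [x],
   and later steps avoid [y], so none uses the edge [xy]. *)
apply/connectP; exists (z :: rcons s x); rewrite /= ?last_rcons //.
rewrite {1}/remove_edge /= ryz !xpair_eqE (eq_sym y x) (negPf neq_xy).
rewrite (eq_sym z x) (negPf neq_xz) andbF /=.
have avoid_y : all (predC1 y) (z :: rcons s x).
  rewrite /= eq_sym neq_yz all_rcons /= neq_xy all_predC.
  by apply/hasPn=> w w_s; apply: contraNneq y_s => <-.
apply: sub_in_path avoid_y path_z => u v /= neq_u neq_v; rewrite /remove_edge /= => ->.
by rewrite !xpair_eqE (negPf neq_u) (negPf neq_v) andbF.
Qed.

Theorem theorem1 (n : nat) (V : finType) (adj : rel V)
    (n_gt0 : (0 < n)%N) (card_V : #|V| = n)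
    (adj_sym : symmetric adj) (adj_irr : irreflexive adj) :
  is_tree adj <->
  (forall lab : V -> 'I_n, bijective lab ->
     basis_of {: 'rV['F_2]_n.-1}%VS (enum (coding_sequence adj lab))).
Proof.
split=> [[conn acyc] lab lab_bij|bases].
  have lab_inj := bij_inj lab_bij; apply/andP; split.
    by apply/eqP; apply/codes_full.
  by apply/codes_free/acyclic_bridges.
(* The enumeration of [V] provides a labeling to which the hypothesis applies. *)
pose lab v := cast_ord card_V (enum_rank v).
have lab_bij : bijective lab.
  by exists (enum_val \o cast_ord (esym card_V)) => v;
    rewrite /lab /= ?cast_ordK ?cast_ordKV ?enum_rankK ?enum_valK ?cast_ordKV.
have lab_inj := bij_inj lab_bij.
have /andP[/eqP full free_codes] := bases lab lab_bij; split.
  by apply/(codes_full lab_inj adj_sym lab_bij).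
by apply/acyclic_bridges/(codes_free lab_inj adj_sym adj_irr).
Qed.
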